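(* Consider a sequence of natural numbers $ t ( n ) $, an integer sequence $ s ( n ) $, four integers $ b_1 \geq 2 $, $b_2 \geq 8$, $ c \geq 0 $ and $ m \geq 2 $ and four polynomials $ A_+ ( z ) $, $ A_- ( z ) $, $ B_+ ( z ) $ and $ B_- ( z ) $ in $ \mathbb{N} [ z ] $. In addition, let $ R $ be the radius of convergence of $ \mathrm{GF}_t ( z ) $ at zero, let $ h = \deg ( B_+ - B_- ) $, let $ E ( n, b ) $ be the expression \[ \left \lfloor \frac{\max\left( b^{n^2 + h n} A_+(b^{- n}) - b^{n^2 + h n} A_-(b^{- n}) ,\, 0 \right)}{\max\left( b^{h n} B_+(b^{- n}) - b^{h n} B_-(b^{- n}) ,\, 0\right)} \right \rfloor \bmod b^n \] and suppose that: \begin{enumerate} \item some term of $ t ( n ) $ is positive, \item the equality $ t ( r ) = s ( r ) + c^{r + 1} $ holds for every integer $ r \geq 0 $, \item the equality $ \mathrm{GF}_t ( z ) = ( A_+ ( z ) - A_- ( z ) ) / ( B_+ ( z ) - B_- ( z ) ) $ holds, \item the fraction $ ( A_+ ( z ) - A_- ( z ) ) / ( B_+ ( z ) - B_- ( z ) ) $ is irreducible, \item the inequality $ B_- ( 0 ) < B_+ ( 0 ) $ holds, \item the inequality $ b_1^{- m} < R $ holds, \item the inequality $ t ( r ) < b_1^{r - 2} $ holds for every integer $ r \geq m $. \end{enumerate} Then $ s ( r ) = E ( r , b_1 ) - c^{r + 1} $ for every integer $ r \geq m $. \newline If, instead of conditions 6 and 7, the sequence $ t ( n ) $ satisfies the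 conditions \begin{enumerate}[(a)] \item the inequality $b_2^{-1} < R$ holds and \item the inequality $t ( r ) < b_2^{r / 3}$ holds for every integer $r \geq 1$, \end{enumerate} then $ s ( r ) = E ( r , b_2 ) - c^{r + 1} $ for every integer $ r \geq 1 $.
   Context: $\mathbb{N}$ denotes the set of non-negative integers; sequences are indexed by $\mathbb{N}$. The generating function $\mathrm{GF}_t(z)$ of a sequence $t(n)$ is the formal power series $\sum_{i\ge 0} t(i) z^i$. The expression $\max(x-y,0)$ is the truncated subtraction of $y$ from $x$. Conventions: $0^0=1$ and $\lfloor x/0\rfloor = 0$, so $x \bmod 0 = x$ and $x \bmod 1 = 0$. *)

(* Defs.v *)
From mathcomp Require Import all_boot all_order all_algebra.
From mathcomp Require Import all_classical all_reals all_analysis.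
Set Implicit Arguments.
Unset Strict Implicit.
Unset Printing Implicit Defensive.
Import Order.TTheory GRing.Theory Num.Theory.
Import numFieldNormedType.Exports.
Local Open Scope classical_set_scope.
Local Open Scope ring_scope.

Definition polyQ (p : {poly nat}) : {poly rat} :=
  map_poly (fun n : nat => n%:R : rat) p.

(* Formal power series over rat are coefficient sequences nat -> rat. *)
Definition GF (t : nat -> nat) : nat -> rat := fun n => (t n)%:R.

Definition fps_of_poly (p : {poly rat}) : nat -> rat := fun n => p`_n.

Definition fps_mul (f g : nat -> rat) : nat -> rat :=
  fun n => \sum_(i < n.+1) f i * g (n - i)%N.

(* f = a / b in the ring of formal power series.  When the constant term of b
   is nonzero, b is a unit of that ring, so such an f exists and is unique. *)
Definition is_fps_quotient (f a b : nat -> rat) : Prop := fps_mul f b =1 a.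

Definition radius_of_convergence (R : realType) (a : nat -> R) : \bar R :=
  ereal_sup [set `|x|%:E | x in [set x : R | cvgn (pseries a x)]].

(* The degree h below is a natural number; size p = deg p + 1 for p != 0.
   The conventions floor(x / 0) = 0 and x mod 0 = x are those of the library
   (in rat, x / 0 = 0). *)
Definition E (Ap Am Bp Bm : {poly nat}) (n b : nat) : int :=
  let h := (size (polyQ Bp - polyQ Bm)).-1 in
  let x : rat := b%:R ^- n in
  let u : rat := b%:R ^+ (n ^ 2 + h * n) in
  let v : rat := b%:R ^+ (h * n) in
  let q : int := Num.floor
    (Num.max (u * (polyQ Ap).[x] - u * (polyQ Am).[x]) 0 /
     Num.max (v * (polyQ Bp).[x] - v * (polyQ Bm).[x]) 0) in
  (q %% (b ^ n)%N)%Z.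

(* Main.v *)
Require Import Defs.
From mathcomp Require Import all_boot all_order all_algebra.
From mathcomp Require Import all_classical all_reals all_analysis.
From mathcomp Require Import ring lra zify.
Import Order.TTheory GRing.Theory Num.Theory.
Import numFieldNormedType.Exports.
Local Open Scope ring_scope.

(**
Put x = b^-n, so that x lies inside the disc of convergence.  There the power
series of t satisfies GF_t(y) B(y) = A(y) for 0 <= y <= x, so a zero of B in
[0, x] would also be a zero of A; coprimality excludes it, and B(0) > 0 gives
B > 0 on [0, x].  Hence both truncated subtractions are harmless and the
quotient equals b^(n^2) GF_t(b^-n) = sum_i t(i) b^(n(n-i)).  Its terms with
i < n are multiples of b^n, the term i = n is t(n) < b^n, and a geometric bound
shows that the terms with i > n add up to less than 1.
*)

(** Padding the shifted coefficients with zeros lets all shifts share one summation range, so that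
    they can be combined linearly at the level of partial sums. *)
Lemma cvg_series_shift (R : realType) (t : nat -> R) (x l : R) (j : nat) :
  (pseries t x @ \oo --> l)%classic ->
  (series (fun k => if (j <= k)%N then t (k - j)%N * x ^+ k else 0) @ \oo -->
    x ^+ j * l)%classic.
Proof.
move=> tl; rewrite -(cvg_shiftn j).
rewrite [X in (X @ _ --> _)%classic](_ : _ = fun n => x ^+ j * pseries t x n).
  exact: cvgMr.
apply/funext => n /=; rewrite /pseries /series /=.
rewrite (big_cat_nat (n := j)) ?leq_addl//= big_nat_cond big1 ?add0r; last first.
  by move=> i; rewrite andbT => /= ij; rewrite leqNgt ij.
rewrite -{1}[j]add0n big_addn addnK mulr_sumr; apply: eq_bigr => i _.
by rewrite leq_addl addnK exprD; ring.
Qed.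

(** Since [B] is a polynomial, the Cauchy product is a finite linear combination of shifts of one
    series, and plain convergence at [x] suffices. The partial sums of [A] then have two limits,
    which must agree. *)
Lemma pseries_mul_poly (R : realType) (t : nat -> R) (A B : {poly R}) (x : R) :
  (forall k, \sum_(i < k.+1) t i * B`_(k - i) = A`_k) ->
  cvgn (pseries t x) -> limn (pseries t x) * B.[x] = A.[x].
Proof.
move=> tBA /cvg_ex[l tl]; rewrite (cvg_lim _ tl)//.
pose c j k := if (j <= k)%N then t (k - j)%N * x ^+ k else 0.
have Al : (series (fun k => A`_k * x ^+ k) @ \oo --> A.[x])%classic.
  apply: cvg_near_cst; exists (size A) => // n /= An.
  by rewrite /series /= big_mkord -horner_coef_wide.
have Bl : (series (fun k => A`_k * x ^+ k) @ \oo --> l * B.[x])%classic.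
  rewrite horner_coef mulr_sumr.
  rewrite [X in (X @ _ --> _)%classic](_ : _ =
      fun n => \sum_(j < size B) B`_j * series (c j) n).
    apply: cvg_big; first exact: add_continuous.
    move=> j _; rewrite mulrCA [l * _]mulrC; apply: cvgMr.
    exact: cvg_series_shift.
  apply/funext => n; rewrite /series /=.
  under [RHS]eq_bigr do rewrite mulr_sumr.
  rewrite exchange_big /=; apply: eq_bigr => k _.
  rewrite -tBA (reindex_inj rev_ord_inj) /= mulr_suml.
  (* Both sums are extended to a common range: the extra terms vanish, either because [c j k] is 0
     for [k < j] or because [B] has no coefficient at [j]. *)
  pose M := maxn k.+1 (size B).
  rewrite (big_ord_widen M (fun j =>
    t (k.+1 - j.+1)%N * B`_(k - (k.+1 - j.+1)) * x ^+ k)) ?leq_maxl//.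
  rewrite (big_ord_widen M (fun j => B`_j * c j k)) ?leq_maxr//.
  rewrite big_mkcond [RHS]big_mkcond; apply: eq_bigr => j _ /=.
  rewrite /c ltnS subSS; case: leqP => jk; case: ltnP => jB; rewrite ?mulr0//.
    by rewrite subKn// (nth_default _ jk) mulr0 mul0r.
  by rewrite subKn// mulrAC mulrC.
exact: cvg_unique Bl Al.
Qed.

Lemma denominator_gt0 (R : realType) (t : nat -> R) (A B : {poly R}) (x : R) :
  (forall k, \sum_(i < k.+1) t i * B`_(k - i) = A`_k) ->
  coprimep A B -> 0 < B.[0] -> 0 <= x ->
  (forall y, 0 <= y <= x -> cvgn (pseries t y)) -> 0 < B.[x].
Proof.
move=> tBA AB B0 x0 cvgt; rewrite ltNge; apply/negP => Bx.
have [|y y0x] := @poly_ivt R (- B) 0 x x0.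
  by rewrite !hornerN oppr_le0 oppr_ge0 (ltW B0) Bx.
rewrite rootN => By; rewrite coprimep_sym in AB.
have := coprimep_root AB By; rewrite -(pseries_mul_poly _ _ _ _ _ tBA); last exact: cvgt.
by rewrite (rootP By) mulr0 eqxx.
Qed.

(** The sign conditions remove both truncations, and the common factor [b ^ (h * n)] cancels in the
    fraction. *)
Lemma E_floor (Ap Am Bp Bm : {poly nat}) (n b : nat) (x : rat) :
  let A := polyQ Ap - polyQ Am in let B := polyQ Bp - polyQ Bm in
  x = b%:R ^- n -> (0 < b)%N -> 0 <= A.[x] -> 0 < B.[x] ->
  E Ap Am Bp Bm n b =
    (Num.floor (b%:R ^+ (n ^ 2) * (A.[x] / B.[x])) %% (b ^ n)%N)%Z.
Proof.
move=> A B xE b0 A0 B0; rewrite /E -/B -xE.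
have bX k : 0 < b%:R ^+ k :> rat by rewrite exprn_gt0// ltr0n.
rewrite -!mulrBr -!hornerN -!hornerD -/A -/B.
rewrite !max_l ?mulr_ge0//; try exact: ltW.
by rewrite exprD -[_ * _ * A.[x]]mulrA -mulrA -mulf_div divff ?mul1r// gt_eqF.
Qed.

(** Common core of both claims, which differ only in the tail bound. A uniform [q < 1] is required
    because bounding each finite tail strictly by 1 would give only a weak inequality in the
    limit. *)
Lemma E_digit (R : realType) (t : nat -> nat) (Ap Am Bp Bm : {poly nat})
    (n b : nat) (q : R) :
  is_fps_quotient (GF t) (fps_of_poly (polyQ Ap - polyQ Am))
    (fps_of_poly (polyQ Bp - polyQ Bm)) ->
  coprimep (polyQ Ap - polyQ Am) (polyQ Bp - polyQ Bm) ->
  (Bm.[0%R] < Bp.[0%R])%N -> (0 < b)%N ->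
  (forall y : R, 0 <= y <= b%:R ^- n ->
     cvgn (pseries (fun i => (t i)%:R) y)) ->
  (t n < b ^ n)%N -> q < 1 ->
  (forall k, \sum_(i < k) (t (n.+1 + i)%N)%:R * (b%:R ^- n) ^+ i.+1 <= q) ->
  E Ap Am Bp Bm n b = (t n)%:Z.
Proof.
set A := polyQ Ap - polyQ Am; set B := polyQ Bp - polyQ Bm.
move=> tBA AB B0 b0 cvgt tn q1 tail.
(* The identity and [E] live over [rat], convergence over [R]; [ratr] carries the data across. *)
pose AR : {poly R} := map_poly ratr A; pose BR : {poly R} := map_poly ratr B.
pose x : rat := b%:R ^- n; pose X : R := b%:R ^- n.
have XE : ratr x = X by rewrite /x fmorphV rmorphXn /= ratr_nat.
have X0 : 0 < X by rewrite invr_gt0 exprn_gt0// ltr0n.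
have tBAR k : \sum_(i < k.+1) (t i)%:R * BR`_(k - i) = AR`_k.
  rewrite coef_map /= -[A`_k]/(fps_of_poly A k) -tBA /fps_mul rmorph_sum /=.
  by apply: eq_bigr => i _; rewrite coef_map /= rmorphM /= ratr_nat.
have ABR : coprimep AR BR by rewrite coprimep_map.
have BR0 : 0 < BR.[0].
  rewrite horner_coef0 coef_map /= ltr0q coefB !coef_map_id0//.
  by rewrite subr_gt0 ltr_nat -!horner_coef0.
have cvgX : cvgn (pseries (fun i => (t i)%:R) X).
  by apply: cvgt; rewrite (ltW X0) lexx.
have BX := denominator_gt0 _ _ _ _ _ tBAR ABR BR0 (ltW X0) cvgt.
have LX := pseries_mul_poly _ _ _ _ _ tBAR cvgX.
set L := limn _ in LX.
have bX k : 0 < b%:R ^+ k :> R by rewrite exprn_gt0// ltr0n.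
(* The terms of index at most [n] form the integer [N0]; the later ones reduce to the tail, since
   [b ^ (n ^ 2)] cancels [X ^ n] and leaves the powers [X ^ i.+1]. *)
pose N0 := (\sum_(i < n.+1) t i * b ^ (n * (n - i)))%N.
have partE k : b%:R ^+ (n ^ 2) * pseries (fun i => (t i)%:R) X (n.+1 + k)%N =
    N0%:R + \sum_(i < k) (t (n.+1 + i)%N)%:R * X ^+ i.+1.
  rewrite /pseries /series /= big_mkord big_split_ord /= mulrDr !mulr_sumr natr_sum.
  congr (_ + _); apply: eq_bigr => i _ /=.
    have iN : (i <= n)%N by rewrite -ltnS.
    rewrite natrM natrX mulrCA; congr (_ * _).
    rewrite /X -exprVn -exprM -mulnn -{2}(subnK iN) mulnDr exprD -mulrA.
    by rewrite exprVn divff ?mulr1// gt_eqF.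
  rewrite mulrCA; congr (_ * _).
  rewrite addSn -addnS exprD mulrA /X -{1}exprVn -exprM exprVn mulnn divff ?mul1r//.
  by rewrite gt_eqF.
have Lb : N0%:R <= b%:R ^+ (n ^ 2) * L <= N0%:R + q.
  apply/andP; split.
    rewrite mulrC -ler_pdivrMr//; apply: limr_ge => //.
    exists n.+1 => // k /= nk.
    rewrite ler_pdivrMr// mulrC -(subnKC nk) partE lerDl.
    by apply: sumr_ge0 => i _; rewrite mulr_ge0// exprn_ge0// ltW.
  rewrite mulrC -ler_pdivlMr//; apply: limr_le => //.
  exists n.+1 => // k /= nk.
  by rewrite ler_pdivlMr// mulrC -(subnKC nk) partE lerD2l.
have hornerR (p : {poly rat}) : (map_poly ratr p).[X] = ratr p.[x].
  by rewrite -XE horner_map.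
have L0 : 0 <= L.
  by rewrite -(pmulr_rge0 _ (bX (n ^ 2)%N)); apply: le_trans (proj1 (andP Lb)).
rewrite (@E_floor _ _ _ _ _ _ x)//; last 2 first.
- by rewrite -(ler0q R) -hornerR -LX mulr_ge0// ltW.
- by rewrite -(ltr0q R) -hornerR.
rewrite -/A -/B.
have -> : Num.floor (b%:R ^+ (n ^ 2) * (A.[x] / B.[x])) = N0%:Z.
  apply: floor_def; rewrite -(ler_rat R) -(ltr_rat R).
  have -> : ratr (b%:R ^+ (n ^ 2) * (A.[x] / B.[x])) = b%:R ^+ (n ^ 2) * L.
    rewrite !rmorphM /= rmorphXn /= ratr_nat fmorphV /= -!hornerR -/AR -/BR -LX mulfK//.
    by rewrite gt_eqF.
  rewrite !ratr_int intrD; move/andP: Lb => [-> Lq] /=.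
  by apply: le_lt_trans Lq _; rewrite ltrD2l.
rewrite /N0 big_ord_recr /= subnn muln0 expn0 muln1.
have -> : (\sum_(i < n) t i * b ^ (n * (n - i)) =
    (\sum_(i < n) t i * b ^ (n * (n - i).-1)) * b ^ n)%N.
  rewrite big_distrl /=; apply: eq_bigr => i _.
  rewrite -mulnA -expnD -mulnSr prednK// subn_gt0.
  exact: ltn_ord.
by rewrite PoszD PoszM modzMDl modz_small.
Qed.

Lemma cvg_pseries_radius (R : realType) (a : nat -> R) (x y : R) :
  (x%:E < radius_of_convergence a)%E -> 0 <= y <= x -> cvgn (pseries a y).
Proof.
move=> /ereal_sup_gt[_ [z /= az <-]]; rewrite lte_fin => xz /andP[y0 yx].
by apply: is_cvg_pseries_inside az _; rewrite ger0_norm//; apply: le_lt_trans xz.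
Qed.

(** The bounds [2 ^- i.+1] alone add up to 1 in the limit; the slack [x] in the first term keeps the
    sums away from 1. *)
Lemma half_geometric_sum (R : realFieldType) (u : nat -> R) (x : R) (k : nat) :
  0 <= x <= 1 -> u 0 <= 2^-1 - x -> (forall i, u i <= 2 ^- i.+1) ->
  \sum_(i < k) u i <= 1 - x.
Proof.
move=> /andP[x0 x1] u0 ui; case: k => [|k]; first by rewrite big_ord0 subr_ge0.
apply: (@le_trans _ _ (1 - x - 2 ^- k.+1)); last first.
  by rewrite gerBl invr_ge0 exprn_ge0.
elim: k => [|k IH]; first by rewrite big_ord1 expr1; lra.
rewrite big_ord_recr /=; apply: le_trans (lerD IH (ui _)) _.
rewrite -!exprVn [_ ^+ k.+2]exprS; lra.
Qed.

Lemma quarter_geometric_sum (R : realFieldType) (u : nat -> R) (k : nat) :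
  (forall i, u i <= 2 ^- (2 * i).+1) -> \sum_(i < k) u i <= 2 / 3.
Proof.
move=> ui; apply: (@le_trans _ _ (2 / 3 * (1 - 2 ^- (2 * k)))); last first.
  by rewrite ler_piMr ?divr_ge0// gerBl invr_ge0 exprn_ge0.
elim: k => [|k IH]; first by rewrite big_ord0 muln0 expr0; lra.
rewrite big_ord_recr /=; apply: le_trans (lerD IH (ui _)) _.
rewrite mulnS !exprS -!exprVn; set z := _ ^+ _; rewrite !invfM -exprVn -/z; lra.
Qed.

Theorem theorem5p4 (R : realType) (t : nat -> nat) (s : nat -> int)
    (b1 b2 c m : nat) (Ap Am Bp Bm : {poly nat})
    (hb1 : (2 <= b1)%N) (hb2 : (8 <= b2)%N) (hm : (2 <= m)%N)
    (h1 : exists n : nat, (0 < t n)%N)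
    (h2 : forall r : nat, (t r)%:Z = s r + (c ^ r.+1)%N%:Z)
    (h3 : is_fps_quotient (GF t) (fps_of_poly (polyQ Ap - polyQ Am))
            (fps_of_poly (polyQ Bp - polyQ Bm)))
    (h4 : coprimep (polyQ Ap - polyQ Am) (polyQ Bp - polyQ Bm))
    (h5 : (Bm.[0%R] < Bp.[0%R])%N) :
  (((b1%:R ^- m)%:E < radius_of_convergence (fun n => (t n)%:R : R))%E ->
   (forall r : nat, (m <= r)%N -> (t r < b1 ^ (r - 2))%N) ->
   forall r : nat, (m <= r)%N ->
     s r = E Ap Am Bp Bm r b1 - (c ^ r.+1)%N%:Z)
  /\
  (((b2%:R^-1)%:E < radius_of_convergence (fun n => (t n)%:R : R))%E ->
   (forall r : nat, (1 <= r)%N ->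
      ((t r)%:R : R) < (b2%:R : R) `^ (r%:R / 3%:R)) ->
   forall r : nat, (1 <= r)%N ->
     s r = E Ap Am Bp Bm r b2 - (c ^ r.+1)%N%:Z).
Proof.
have digitE r b : E Ap Am Bp Bm r b = (t r)%:Z ->
    s r = E Ap Am Bp Bm r b - (c ^ r.+1)%N%:Z.
  by move=> ->; rewrite h2 addrK.
split=> [Rb tb r mr|Rb tb r r1]; apply: digitE.
- have b0 : (0 < b1)%N by apply: leq_trans hb1.
  have bR0 k : 0 < b1%:R ^+ k :> R by rewrite exprn_gt0// ltr0n.
  have r2 : (2 <= r)%N by apply: leq_trans mr.
  pose x : R := b1%:R ^- r.
  have x0 : 0 < x by rewrite invr_gt0.
  apply: (@E_digit R t _ _ _ _ _ _ (1 - x)) => //.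
  + move=> y /andP[y0 yx]; apply: cvg_pseries_radius Rb _.
    rewrite y0 (le_trans yx)// lef_pV2 ?posrE//.
    by rewrite ler_weXn2l// ler1n.
  + by apply: leq_trans (tb _ mr) _; rewrite leq_exp2l// leq_subr.
  + by rewrite gtrBl.
  + move=> k; apply: (@half_geometric_sum R
      (fun i => (t (r.+1 + i)%N)%:R * x ^+ i.+1)) => [||i].
    * by rewrite ltW//= invf_le1// exprn_ege1// ler1n.
    (* The slack comes from integrality: [t r.+1 < b1 ^ (r - 1)] means [t r.+1 + 1 <= b1 ^ (r - 1)],
       and this extra unit times [b1 ^- r] is [x]. *)
    * rewrite addn0 expr1 lerBrDr -[X in _ + X]mul1r -mulrDl natr1.
      have /(_ r.+1) := tb; rewrite (leq_trans mr)// => /(_ isT) tr.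
      rewrite ler_pdivrMr//.
      apply: (@le_trans _ _ (b1 ^ (r.+1 - 2))%:R); first by rewrite ler_nat.
      rewrite ler_pdivlMl// -!natrX -natrM ler_nat.
      apply: (@leq_trans (b1 * b1 ^ (r.+1 - 2))); first by rewrite leq_mul2r hb1 orbT.
      by rewrite -expnS leq_exp2l//; lia.
    * rewrite /x -exprVn -exprM exprVn ler_pdivrMr// ler_pdivlMl ?exprn_gt0//.
      rewrite -!natrX -natrM ler_nat.
      have /(_ (r.+1 + i)%N) := tb.
      rewrite (leq_trans mr) ?(leq_trans (leqnSn r)) ?leq_addr// => /(_ isT)/ltnW tr.
      (* With [2 <= b1], it remains to compare exponents: [r + 2 * i <= r * i.+1], true as
         [2 <= r]. *)
      apply: (@leq_trans (b1 ^ i.+1 * b1 ^ (r.+1 + i - 2))).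
        by rewrite leq_mul// leq_exp2r.
      by rewrite -expnD leq_exp2l//; nia.
- have b0 : (0 < b2)%N by apply: leq_trans hb2.
  (* The cube root [d] turns the real exponents into natural ones, and [8 <= b2] becomes
     [2 <= d]. *)
  pose d : R := b2%:R `^ 3^-1.
  have dX k : b2%:R `^ (k%:R / 3) = d ^+ k.
    by rewrite -powR_mulrn ?powR_ge0// -powRrM mulrC.
  have d3 : d ^+ 3 = b2%:R by rewrite -dX divff// powRr1.
  have d2 : 2 <= d.
    rewrite leNgt; apply/negP => d2.
    suff : d ^+ 3 < 2 ^+ 3 by rewrite d3 -natrX ltr_nat ltnNge hb2.
    by rewrite ltrXn2r ?powR_ge0.
  have d1 : 1 <= d by apply: le_trans d2; rewrite ler1n.
  have d0 k : 0 < d ^+ k by rewrite exprn_gt0// (lt_le_trans ltr01).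
  have tb' k : (1 <= k)%N -> (t k)%:R < d ^+ k by move=> /tb; rewrite dX.
  apply: (@E_digit R t _ _ _ _ _ _ (2 / 3)) => //.
  + move=> y /andP[y0 yx]; apply: cvg_pseries_radius Rb _.
    rewrite y0 (le_trans yx)// lef_pV2 ?posrE ?exprn_gt0 ?ltr0n//.
    by rewrite ler_eXnr// ler1n.
  + rewrite -(ltr_nat R) natrX (lt_le_trans (tb' _ r1))// -d3 -exprM.
    by rewrite ler_weXn2l//; lia.
  + lra.
  + move=> k; apply: (@quarter_geometric_sum R
      (fun i => (t (r.+1 + i)%N)%:R * (b2%:R ^- r) ^+ i.+1)) => i.
    apply: (@le_trans _ _ (d ^- (2 * i).+1)); last first.
      by rewrite lef_pV2 ?posrE ?exprn_gt0 ?(lt_le_trans _ d2)// lerXn2r// nnegrE ltW// (lt_le_trans _ d2).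
    rewrite -d3 -!exprVn -!exprM !exprVn ler_pdivrMr// ler_pdivlMl//.
    (* The exponents satisfy [3 * i + r + 2 <= 3 * r * i.+1], with equality at [r = 1]. *)
    apply: (@le_trans _ _ (d ^+ (2 * i).+1 * d ^+ (r.+1 + i))).
      by rewrite ler_pM2l// ltW// tb'.
    by rewrite -exprD ler_weXn2l//; nia.
Qed.
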